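(* Let $k$ be a positive integer, let $(X_\lambda)_{\lambda \in \Lambda}$ and $(Y_\lambda)_{\lambda \in \Lambda}$ be two families of complex Banach spaces, and let $Q_\lambda \in \mathcal{P}(^k X_\lambda, Y_\lambda)$ be a norm-one polynomial for every $\lambda \in \Lambda$. Let $E$ be $c_0$ or $\ell_\infty$, and let $X = \left[ \bigoplus_{\lambda \in \Lambda} X_\lambda \right]_E$ and $Y = \left[ \bigoplus_{\lambda \in \Lambda} Y_\lambda \right]_E$. Define the $k$-homogeneous polynomial $Q: X \rightarrow Y$ by $$Q[(x_\lambda)_{\lambda \in \Lambda}] = (Q_\lambda(x_\lambda))_{\lambda \in \Lambda}$$ for every $(x_\lambda)_{\lambda \in \Lambda} \in X$. Then $$n_{Q}^{(k)}(X, Y) = \inf_{\lambda\in\Lambda} n_{Q_\lambda}^{(k)}(X_\lambda, Y_\lambda).$$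
   Context: For a complex Banach space $X$, $X^*$ is the topological dual, $B_X$ the closed unit ball and $S_X$ the unit sphere. $\left[\bigoplus_{\lambda\in\Lambda}X_\lambda\right]_E$ denotes the $E$-sum of the family: the Banach space of all families $(x_\lambda)_{\lambda\in\Lambda}$ with $x_\lambda\in X_\lambda$ and $(\|x_\lambda\|)_{\lambda}\in E(\Lambda)$, with norm $\sup_\lambda\|x_\lambda\|$. A map $P:X\to Y$ is a $k$-homogeneous polynomial if there is a $k$-linear map $A:X^k\to Y$ with $P(x)=A(x,\dots,x)$ for all $x\in X$. $\mathcal{P}(^k X,Y)$ is the Banach space of continuous $k$-homogeneous polynomials from $X$ to $Y$ with norm $\|P\|=\sup_{x\in B_X}\|P(x)\|$. For $Q\in\mathcal{P}(^kX,Y)$ with $\|Q\|=1$ and $P\in\mathcal{P}(^kX,Y)$, let $V_Q(P) := \bigcap_{\delta > 0} \overline{\{y^*(P(x)) : y^* \in S_{Y^*},\ x \in S_X,\ \operatorname{Re} y^*(Q(x))>1-\delta\}}$ and $v_Q(P) := \sup\{|t| : t \in V_Q(P)\}$. The polynomial numerical index of $(X,Y)$ with respect to $Q$ is $n_Q^{(k)}(X,Y):=\inf\{v_Q(P):P\in \mathcal{P}(^k X,Y),\ \|P\|=1\}$. *)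

(* Defs.v *)
From HB Require Import structures.
From mathcomp Require Import all_boot all_order all_algebra.
From mathcomp Require Import all_classical all_reals all_analysis.
From mathcomp Require Import complex lra.

Set Implicit Arguments.
Unset Strict Implicit.
Unset Printing Implicit Defensive.

Import Order.TTheory GRing.Theory Num.Theory.
Import numFieldNormedType.Exports.

Local Open Scope classical_set_scope.
Local Open Scope ring_scope.
Local Open Scope complex_scope.

(* Norms of complex normed spaces take their values in R[i]; [rnorm] is the
   same number as an element of R, where suprema and infima exist. *)
Definition rnorm (R : realType) (V : normedModType R[i]) (x : V) : R :=
  complex.Re `|x|.

Section rnorm_theory.
Variables (R : realType) (V : normedModType R[i]).
Implicit Types x y : V.

Lemma rnormE x : `|x| = (rnorm x)%:C.
Proof. by rewrite /rnorm RRe_real. Qed.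

Lemma rnorm_ge0 x : 0 <= rnorm x.
Proof. rewrite -ler0c -rnormE; exact: normr_ge0. Qed.

Lemma rnormD x y : rnorm (x + y) <= rnorm x + rnorm y.
Proof. by rewrite -lecR rmorphD/= -!rnormE ler_normD. Qed.

Lemma rnormZ (a : R[i]) x : rnorm (a *: x) = complex.Re `|a| * rnorm x.
Proof.
by apply/complexI; rewrite rmorphM/= -!rnormE normrZ.
Qed.

Lemma rnorm0_eq0 x : rnorm x = 0 -> x = 0.
Proof. by move=> x0; apply/normr0_eq0; rewrite rnormE x0. Qed.

Lemma rnorm0 : rnorm (0 : V) = 0.
Proof. by rewrite /rnorm normr0. Qed.

End rnorm_theory.

Section polynomial.
Variables (R : realType) (X Y : normedModType R[i]).

Definition multilinear (k : nat) (A : ('I_k -> X) -> Y) : Prop :=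
  forall (v : 'I_k -> X) (i : 'I_k), linear (fun x => A (dfwith v i x)).

(* Continuity is required of P only, not of the k-linear map A. *)
Definition hpoly (k : nat) (P : X -> Y) : Prop :=
  continuous P /\
  exists A : ('I_k -> X) -> Y, multilinear A /\ forall x, P x = A (fun=> x).

(* The norm of polynomials and the dual norm of linear functionals alike; the
   supremum is over a nonempty set, bounded when f is one of these. *)
Definition ballnorm (f : X -> Y) : R :=
  sup [set rnorm (f x) | x in [set x : X | rnorm x <= 1]].

End polynomial.

Section numerical_index.
Variables (R : realType).

Definition dual_sphere (Y : normedModType R[i]) : set {linear Y -> R[i]^o} :=
  [set f | continuous f /\ ballnorm f = 1].

Variables (X Y : normedModType R[i]).

Definition num_range (Q P : X -> Y) : set R[i]^o :=
  \bigcap_(d in [set d : R | 0 < d])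
    closure [set t : R[i]^o | exists f : {linear Y -> R[i]^o}, exists x : X,
      [/\ dual_sphere f, rnorm x = 1,
          1 - d < complex.Re (f (Q x)) & t = f (P x)]].

Definition num_radius (Q P : X -> Y) : R :=
  sup [set rnorm t | t in num_range Q P].

Definition num_index (k : nat) (Q : X -> Y) : R :=
  inf [set num_radius Q P | P in [set P | hpoly k P /\ ballnorm P = 1]].

End numerical_index.

(* c_0 and l_infty, over an arbitrary index type. *)
Inductive seqspace := czero | linfty.

Definition seqspace_mem (R : realType) (Lam : Type) (E : seqspace)
    (a : Lam -> R) : Prop :=
  match E with
  | czero => forall e : R, 0 < e -> finite_set [set l | e <= `|a l|]
  | linfty => exists M : R, forall l, `|a l| <= M
  end.

Section seqspace_theory.
Variables (R : realType) (Lam : Type) (E : seqspace).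
Implicit Types a b : Lam -> R.
Local Notation mem := (@seqspace_mem R Lam E).

Lemma seqspace_mem0 : mem (fun=> 0).
Proof.
case: E => /= [e e0|]; last by exists 0 => l; rewrite normr0.
rewrite (_ : [set _ | _] = set0)//; apply/seteqP; split => // l /=.
by rewrite normr0 leNgt e0.
Qed.

Lemma seqspace_mem_le a b : (forall l, `|b l| <= `|a l|) -> mem a -> mem b.
Proof.
move=> ba; case: E => /= [ca e e0|[M aM]]; last first.
  by exists M => l; exact: le_trans (aM l).
by apply: sub_finite_set (ca e e0) => l /= /le_trans; apply.
Qed.

Lemma seqspace_memD a b : mem a -> mem b -> mem (a \+ b).
Proof.
case: E => /= [ca cb e e0|[M aM] [N bN]]; last first.
  exists (M + N) => l; rewrite (le_trans (ler_normD _ _))//; exact: lerD.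
have e20 : 0 < e / 2 by rewrite divr_gt0.
have : finite_set ([set l | e / 2 <= `|a l|] `|` [set l | e / 2 <= `|b l|]).
  by rewrite finite_setU; split; [exact: ca|exact: cb].
apply: sub_finite_set => l /= le.
have [|al] := leP (e / 2) `|a l|; first by left.
have [|bl] := leP (e / 2) `|b l|; first by right.
have := le_lt_trans (le_trans le (ler_normD _ _)) (ltrD al bl).
by rewrite -splitr ltxx.
Qed.

Lemma seqspace_memZ (c : R) a : mem a -> mem (fun l => c * a l).
Proof.
have [->|c0] := eqVneq c 0.
  by move=> _; apply: seqspace_mem_le seqspace_mem0 => l; rewrite mul0r.
have nc0 : 0 < `|c| by rewrite normr_gt0.
case: E => /= [ca e e0|[M aM]]; last first.
  by exists (`|c| * M) => l; rewrite normrM ler_pM2l.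
apply: sub_finite_set (ca (e / `|c|) (divr_gt0 e0 nc0)) => l /=.
by rewrite normrM ler_pdivrMr// mulrC.
Qed.

Lemma seqspace_mem_closed a :
  (forall e : R, 0 < e -> exists2 b, mem b & forall l, `|a l| <= `|b l| + e) ->
  mem a.
Proof.
case: E => /= [H e e0|H]; last first.
  have [b [M bM] ab] := H 1 ltr01.
  by exists (M + 1) => l; rewrite (le_trans (ab l))// lerD2r.
have e20 : 0 < e / 2 by rewrite divr_gt0.
have [b cb ab] := H _ e20; apply: sub_finite_set (cb _ e20) => l /= el.
by have := le_trans el (ab l); rewrite {1}(splitr e) lerD2r.
Qed.

Lemma seqspace_mem_bounded a : mem a -> exists M : R, forall l, `|a l| <= M.
Proof.
case: E => //= /(_ 1 ltr01) fA.
have /finite_seqP[s sE] :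
  finite_set ((fun l => `|a l|) @` [set l | 1 <= `|a l|]).
  exact: finite_image.
exists (\big[Num.max/1]_(r <- s) r) => l.
have [al|al] := leP 1 `|a l|; last first.
  apply: (le_trans (ltW al)); exact: bigmax_ge_id.
apply: (@le_bigmax_seq _ _ _ s 1 `|a l| xpredT idfun) => //.
have : [set` s] `|a l| by rewrite -sE /=; exists l.
by [].
Qed.

End seqspace_theory.

Section dsum.
Variables (R : realType) (Lam : Type) (E : seqspace).
Variable X : Lam -> completeNormedModType R[i].

Record dsum := Dsum {
  dsum_fun :> forall l, X l;
  dsum_mem : seqspace_mem E (fun l => rnorm (dsum_fun l)) }.

Implicit Types x y z : dsum.

Lemma dsumP x y : (forall l, x l = y l) -> x = y.
Proof.
case: x y => [x px] [y py] /= xy.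
have {}xy : x = y by apply/functional_extensionality_dep.
by case: _ / xy in py *; congr Dsum; exact: Prop_irrelevance.
Qed.

Fact dsum0_mem : seqspace_mem E (fun l => rnorm (0 : X l)).
Proof.
by apply: seqspace_mem_le (seqspace_mem0 R Lam E) => l; rewrite rnorm0.
Qed.

Fact dsumD_mem x y : seqspace_mem E (fun l => rnorm (x l + y l)).
Proof.
apply: seqspace_mem_le (seqspace_memD (dsum_mem x) (dsum_mem y)) => l /=.
by rewrite !ger0_norm ?addr_ge0 ?rnorm_ge0// rnormD.
Qed.

Fact dsumZ_mem (a : R[i]) x : seqspace_mem E (fun l => rnorm (a *: x l)).
Proof.
apply: seqspace_mem_le (seqspace_memZ (complex.Re `|a|) (dsum_mem x)) => l /=.
by rewrite rnormZ.
Qed.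

Fact dsumN_mem x : seqspace_mem E (fun l => rnorm (- x l)).
Proof.
by apply: seqspace_mem_le (dsum_mem x) => l; rewrite /rnorm normrN.
Qed.

HB.instance Definition _ := gen_eqMixin dsum.
HB.instance Definition _ := gen_choiceMixin dsum.

Let add x y := Dsum (dsumD_mem x y).
Let opp x := Dsum (dsumN_mem x).
Let scale a x := Dsum (dsumZ_mem a x).

Let addA : associative add.
Proof. by move=> x y z; apply: dsumP => l /=; rewrite addrA. Qed.
Let addC : commutative add.
Proof. by move=> x y; apply: dsumP => l /=; rewrite addrC. Qed.
Let add0 : left_id (Dsum dsum0_mem) add.
Proof. by move=> x; apply: dsumP => l /=; rewrite add0r. Qed.
Let addN : left_inverse (Dsum dsum0_mem) opp add.
Proof. by move=> x; apply: dsumP => l /=; rewrite addNr. Qed.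

HB.instance Definition _ := GRing.isZmodule.Build dsum addA addC add0 addN.

Let scaleA a b x : scale a (scale b x) = scale (a * b) x.
Proof. by apply: dsumP => l /=; rewrite scalerA. Qed.
Let scale1 : left_id 1 scale.
Proof. by move=> x; apply: dsumP => l /=; rewrite scale1r. Qed.
Let scaleDr : right_distributive scale +%R.
Proof. by move=> a x y; apply: dsumP => l /=; rewrite scalerDr. Qed.
Let scaleDl x : {morph scale^~ x : a b / a + b}.
Proof. by move=> a b; apply: dsumP => l /=; rewrite scalerDl. Qed.

HB.instance Definition _ :=
  GRing.Zmodule_isLmodule.Build R[i] dsum scaleA scale1 scaleDr scaleDl.

(* The supremum is 0 when Lam is empty. *)
Definition dsum_rnorm x : R := sup (range (fun l => rnorm (x l))).

Let dsum_rnorm_ub x l : rnorm (x l) <= dsum_rnorm x.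
Proof.
have [M xM] := seqspace_mem_bounded (dsum_mem x).
apply: sup_upper_bound; last by exists l.
split; first by exists (rnorm (x l)); exists l.
by exists M => _ [l' _ <-]; rewrite (le_trans (ler_norm _)).
Qed.

Let dsum_rnorm_le x (M : R) :
  0 <= M -> (forall l, rnorm (x l) <= M) -> dsum_rnorm x <= M.
Proof.
move=> M0 xM; rewrite /dsum_rnorm.
have [->|/set0P ne0] := eqVneq (range (fun l => rnorm (x l))) set0.
  by rewrite sup0.
by apply: ge_sup => // _ [l _ <-].
Qed.

Let dsum_rnorm_ge0 x : 0 <= dsum_rnorm x.
Proof.
rewrite /dsum_rnorm.
have [->|/set0P [_ [l _ _]]] := eqVneq (range (fun l => rnorm (x l))) set0.
  by rewrite sup0.
exact: le_trans (rnorm_ge0 (x l)) (dsum_rnorm_ub x l).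
Qed.

Let norm x : R[i] := (dsum_rnorm x)%:C.

Let ler_normD x y : norm (x + y) <= norm x + norm y.
Proof.
rewrite /norm -rmorphD lecR; apply: dsum_rnorm_le => [|l].
  by rewrite addr_ge0.
by rewrite (le_trans (rnormD _ _))// lerD.
Qed.

Let norm0_eq0 x : norm x = 0 -> x = 0.
Proof.
move=> /complexI x0; apply: dsumP => l; apply/rnorm0_eq0/le_anti.
by rewrite rnorm_ge0 -x0 dsum_rnorm_ub.
Qed.

Let dsum_rnormZ_le (a : R[i]) x :
  dsum_rnorm (a *: x) <= complex.Re `|a| * dsum_rnorm x.
Proof.
have a0 : 0 <= complex.Re `|a| by exact: (@rnorm_ge0 R R[i]^o a).
apply: dsum_rnorm_le => [|l]; first by rewrite mulr_ge0.
by rewrite /= rnormZ ler_wpM2l.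
Qed.

Let normZ (a : R[i]) x : norm (a *: x) = `|a| * norm x.
Proof.
rewrite /norm (@rnormE R R[i]^o a) -rmorphM; congr _%:C; apply/le_anti.
rewrite dsum_rnormZ_le/=.
have [->|a0] := eqVneq a 0; first by rewrite /rnorm normr0 mul0r.
have na0 : 0 < @rnorm R R[i]^o a.
  by rewrite -ltcR -rnormE normr_gt0.
rewrite -ler_pdivlMl// -[in X in X <= _](scale1r x) -(mulVf a0) -scalerA.
rewrite (le_trans (dsum_rnormZ_le _ _))// ler_wpM2r//.
rewrite le_eqVlt; apply/orP; left; apply/eqP/complexI.
by rewrite RRe_real ?normr_real// normfV fmorphV/= -rnormE.
Qed.

HB.instance Definition _ :=
  @Lmodule_isNormed.Build R[i] dsum norm ler_normD normZ norm0_eq0.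

Lemma dsum_normE x : `|x| = (sup (range (fun l => rnorm (x l))))%:C.
Proof. by []. Qed.

Lemma dsum_rnormE x : rnorm x = sup (range (fun l => rnorm (x l))).
Proof. by []. Qed.

Lemma dsum_coord_le x l : rnorm (x l) <= rnorm x.
Proof. exact: dsum_rnorm_ub. Qed.

Let dsum_complete (F : set_system dsum) :
  ProperFilter F -> cauchy F -> cvg F.
Proof.
move=> FF Fc.
have Fe (e : R) : 0 < e ->
    exists x, F [set z | forall l, rnorm (x l - z l) < e].
  move=> e0; have [|x Fx] := (cauchyP F).1 Fc e%:C; first by rewrite ltcR.
  exists x; apply: filterS Fx => z; rewrite -ball_normE /= rnormE ltcR => xz l.
  exact: le_lt_trans (dsum_coord_le (x - z) l) xz.
have Fcoord l : cvg ((fun x : dsum => x l) @ F).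
  apply: cauchy_cvg; apply: cauchy_exP => e e0.
  have eE : e = (complex.Re e)%:C by rewrite RRe_real ?gtr0_real.
  have [|x Fx] := Fe (complex.Re e); first by rewrite -ltcR -eE.
  exists (x l); rewrite /=; apply: filterS Fx => z /(_ l) xz.
  by rewrite -ball_normE /= rnormE eE ltcR.
pose y0 l : X l := lim ((fun x : dsum => x l) @ F).
have Fy0 (e : R) : 0 < e -> F [set z : dsum | forall l, rnorm (y0 l - z l) <= e].
  move=> e0; have e30 : 0 < e / 3 by rewrite divr_gt0.
  have [x Fx] := Fe _ e30.
  have Fx' := Fx; apply: filterS Fx' => z + l => /(_ l) xz.
  have [w [xw yw]] : exists w : dsum,
      rnorm (x l - w l) < e / 3 /\ rnorm (y0 l - w l) <= e / 3.
    apply: (@filter_ex _ F); apply: filterI.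
      by apply: filterS Fx => w; exact.
    have /cvgrPdist_le /(_ (e / 3)%:C) := Fcoord l.
    rewrite ltcR => /(_ e30); apply: filterS => w.
    by rewrite rnormE lecR.
  have -> : y0 l - z l = (y0 l - w l) + ((w l - x l) + (x l - z l)).
    by rewrite !subrKA.
  have wx : rnorm (w l - x l) = rnorm (x l - w l) by rewrite /rnorm distrC.
  rewrite (le_trans (rnormD _ _))//.
  rewrite (le_trans (lerD (lexx _) (rnormD _ _)))// wx.
  rewrite (le_trans (lerD yw (lerD (ltW xw) (ltW xz))))//.
  lra.
have y0_mem : seqspace_mem E (fun l => rnorm (y0 l)).
  apply: seqspace_mem_closed => e e0.
  have [z yz] := @filter_ex _ F _ _ (Fy0 _ e0).
  exists (fun l => rnorm (z l)); first exact: dsum_mem.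
  move=> l; rewrite !ger0_norm ?rnorm_ge0// -[in leLHS](subrK (z l) (y0 l)).
  by rewrite (le_trans (rnormD _ _))// addrC lerD2l.
apply: (cvgP (Dsum y0_mem)); apply/(@cvgrPdist_le _ _ _ F _ id) => e e0.
have eE : e = (complex.Re e)%:C by rewrite RRe_real ?gtr0_real.
have re0 : 0 < complex.Re e by rewrite -ltcR -eE.
apply: filterS (Fy0 _ re0) => z yz; rewrite eE rnormE lecR.
by apply: dsum_rnorm_le => [|l]; [exact: ltW|exact: yz].
Qed.

HB.instance Definition _ := Uniform_isComplete.Build dsum dsum_complete.

End dsum.

Section homogeneous.
Variables (R : realType) (X Y : normedModType R[i]) (k : nat).

Lemma hpolyZ (P : X -> Y) : hpoly k P ->
  forall (a : R[i]) x, P (a *: x) = a ^+ k *: P x.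
Proof.
move=> [_ [A [mA PA]]] a x; rewrite !PA.
have AZ v i u : A (dfwith v i (a *: u)) = a *: A (dfwith v i u).
  have f0 : A (dfwith v i 0) = 0.
    have := mA v i 1 0 0; rewrite scale1r addr0 scale1r => /esym/eqP.
    by rewrite -subr_eq0 addrK => /eqP.
  by have := mA v i a u 0; rewrite addr0 f0 addr0.
pose w m := (fun i : 'I_k => if (i < m)%N then a *: x else x).
have wA m : (m <= k)%N -> A (w m) = a ^+ m *: A (fun=> x).
  elim: m => [_|m IH mk]; first by rewrite expr0 scale1r.
  have e1 : w m.+1 = dfwith (w m) (Ordinal mk) (a *: x).
    apply/funext => j; rewrite /w; case: dfwithP => [|j' /eqP jm].
      by rewrite /= ltnSn.
    have {}jm : (m != j')%N by apply/eqP => jm'; apply: jm; apply/val_inj.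
    by rewrite ltnS leq_eqVlt eq_sym (negbTE jm).
  have e2 : w m = dfwith (w m) (Ordinal mk) x.
    apply/funext => j; rewrite {1}/w; case: dfwithP => [|//].
    by rewrite /= ltnn.
  by rewrite e1 AZ -e2 IH ?exprS ?scalerA// ltnW.
rewrite -(wA k (leqnn k)); congr A; apply/funext => i.
by rewrite /w ltn_ord.
Qed.

Lemma hpoly_bound (P : X -> Y) : (0 < k)%N -> hpoly k P -> ballnorm P = 1 ->
  forall x, rnorm (P x) <= rnorm x ^+ k.
Proof.
move=> k0 hP P1 x.
have [x0|x0] := eqVneq (rnorm x) 0.
  rewrite x0 (rnorm0_eq0 x0) -(scaler0 _ 0) hpolyZ//.
  by rewrite !expr0n gtn_eqF// scale0r rnorm0.
have xp : 0 < rnorm x by rewrite lt_def x0 rnorm_ge0.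
have hs : has_sup [set rnorm (P x) | x in [set x : X | rnorm x <= 1]].
  apply: contrapT => /sup_out; rewrite -/(ballnorm P) P1.
  by move/eqP; rewrite oner_eq0.
pose u := (rnorm x)^-1%:C *: x.
have nr (r : R) : 0 <= r -> complex.Re `|r%:C| = r.
  by move=> r0; rewrite ger0_norm// ler0c.
have Pu : rnorm (P u) <= 1.
  rewrite -P1; apply: sup_upper_bound hs _ _; exists u => //=.
  by rewrite rnormZ nr ?invr_ge0 ?rnorm_ge0// mulVf.
have xE : x = (rnorm x)%:C *: u.
  by rewrite scalerA -rmorphM divff// scale1r.
rewrite [in leLHS]xE hpolyZ// -rmorphXn rnormZ nr ?exprn_ge0 ?rnorm_ge0//.
by rewrite ler_piMr// exprn_ge0// rnorm_ge0.
Qed.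

End homogeneous.

Section dsum_map.
Variables (R : realType) (Lam : Type) (E : seqspace).
Variables (X Y : Lam -> completeNormedModType R[i]) (k : nat).
Variable Q : forall l, X l -> Y l.
Hypotheses (k0 : (0 < k)%N) (hQ : forall l, hpoly k (@Q l))
  (nQ : forall l, ballnorm (@Q l) = 1).

Fact dsum_map_mem (x : dsum E X) :
  seqspace_mem E (fun l => rnorm (Q (x l))).
Proof.
have Qx l : rnorm (Q (x l)) <= rnorm (x l) ^+ k by exact: hpoly_bound.
case: x Qx => /= x; case: E => /= [cx Qx e e0|[M xM] Qx].
  have m0 : 0 < Num.min 1 e by rewrite lt_min ltr01.
  apply: sub_finite_set (cx _ m0) => l /=.
  rewrite !ger0_norm ?rnorm_ge0// => eQ; rewrite leNgt; apply/negP.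
  rewrite lt_min => /andP[x1 xe].
  have := le_trans eQ (Qx l); rewrite leNgt => /negP; apply.
  apply: le_lt_trans xe; rewrite -{2}(expr1 (rnorm (x l))).
  by rewrite ler_wiXn2l// ?rnorm_ge0// ltW.
exists (M ^+ k) => l; rewrite ger0_norm ?rnorm_ge0//.
rewrite (le_trans (Qx l))// lerXn2r ?nnegrE ?rnorm_ge0//.
  by rewrite (le_trans _ (xM l)).
by rewrite (le_trans (ler_norm _)).
Qed.

(* The proof arguments give |Q_l x| <= |x|^k for all l, so that the image
   stays in the E-sum. *)
Definition dsum_map (x : dsum E X) : dsum E Y := Dsum (dsum_map_mem x).

End dsum_map.

(* Main.v *)
From HB Require Import structures.
Require Import Defs.
From mathcomp Require Import all_boot all_order all_algebra.
From mathcomp Require Import all_solvable all_field.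
From mathcomp Require Import all_classical all_reals all_analysis.
From mathcomp Require Import complex ring lra.

(** The index of the sum is bounded above and below by transporting polynomials
between the sum and one summand.

For the upper bound, a norm-one polynomial [P] from [X_l] to [Y_l] is extended
to the sum as [x |-> P (x_l)], placed in coordinate [l]
([num_radius_extend]).  Its numerical radius does not grow: a functional [f] of
norm one on the sum splits as its restriction [g] to [Y_l] plus a remainder,
with norms adding up to at most 1 ([dsum_functional_split]).  So if [f] almost
norms [Q x], say [Re (f (Q x)) > 1 - s ^+ 2], then [Re (g (Q_l (x_l)))] exceeds
[|g| - s ^+ 2] and hence, once [|g| > s], the normalised [g] and [x_l] form a
pair that norms [Q_l] up to [s] ([near_norming_restrict]); if instead
[|g| <= s], the value [f (P x)] has modulus at most [s].

For the lower bound, a norm-one polynomial [P] on the sum is compressed to a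
polynomial [S] on a summand ([num_radius_compress]).  Choose [x] in the ball and
a coordinate [l] with [|P x|_l] close to 1, and replace [x_l] by a unit vector
[u]: writing [x_l = t u] with [0 <= t <= 1], the mean value property over roots
of unity expresses [P x] as the average of the values of [P] at points of the
ball, one of which has coordinate [u], so that this value also has norm close to
1 ([hpoly_boundary_value]).  If [z] is the rest of [x] and [h] a functional of
norm one with [h u = 1] ([norming_functional]), then [T y = y + h(y) z] embeds
[X_l] isometrically in the sum, [S y = (P (T y))_l] has norm close to 1, and
every pair [(g, y)] that almost norms [Q_l] gives the pair [(g o proj_l, T y)]
that norms [Q] equally well and yields the same value of [S] and of [P].

The radii are compared on the approximating sets rather than on the numerical
ranges themselves; compactness of the closed disc makes this enough
([le_num_radius]). *)

Set Implicit Arguments.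
Unset Strict Implicit.
Unset Printing Implicit Defensive.

Import Order.TTheory GRing.Theory Num.Theory.
Import numFieldNormedType.Exports.

Local Open Scope classical_set_scope.
Local Open Scope ring_scope.
Local Open Scope complex_scope.

(** * The Hahn-Banach theorem for real-valued sublinear functions *)

Section sublinear.
Variables (R : realType) (V : lmodType R[i]).
Implicit Types (p q : V -> R) (x y : V).

(** Only real scalars act, so that real-linear functions on a complex space are
covered; the inequality for [a >= 0] is enough to give equality. *)
Definition sublinear p :=
  (forall x y, p (x + y) <= p x + p y) /\
  (forall (a : R) x, 0 <= a -> p (a%:C *: x) <= a * p x).

Lemma sublinear0 p : sublinear p -> p 0 = 0.
Proof.
move=> [pD pZ]; apply/le_anti/andP; split.
  by have := pZ 0 0 (lexx _); rewrite scaler0 mul0r.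
by have := pD 0 0; rewrite addr0 -{1}(addr0 (p 0)) lerD2l.
Qed.

Lemma sublinear_geN p x : sublinear p -> - p (- x) <= p x.
Proof.
move=> sp; rewrite -subr_ge0 opprK -(sublinear0 sp) -[X in p X](subrr x).
exact: sp.1.
Qed.

Lemma sublinear_eqZ p (a : R) x : sublinear p -> 0 <= a ->
  p (a%:C *: x) = a * p x.
Proof.
move=> sp; rewrite le_eqVlt => /orP[/eqP <-|a0].
  by rewrite scale0r mul0r sublinear0.
apply/le_anti; rewrite sp.2 ?(ltW a0)//= -ler_pdivlMl//.
have -> : p x = p (a^-1%:C *: (a%:C *: x)).
  by rewrite scalerA -rmorphM/= mulVf ?gt_eqF// scale1r.
by rewrite sp.2// invr_ge0 ltW.
Qed.

(** The largest sublinear minorant of [p] whose value at [- y] is at most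
[- p y], that is, [p] made additive along the ray through [y]. *)
Definition shrink p y x : R :=
  inf [set p (x + t%:C *: y) - t * p y | t in [set t : R | 0 <= t]].

Lemma shrink_lb p y x t : sublinear p -> 0 <= t ->
  shrink p y x <= p (x + t%:C *: y) - t * p y.
Proof.
move=> sp t0; apply: ge_inf; last by exists t.
exists (- p (- x)) => _ [s /= s0 <-].
rewrite -(sublinear_eqZ _ sp s0) lerBrDr addrC lerBlDr.
have := sp.1 (x + s%:C *: y) (- x).
by rewrite addrC addrA addNr add0r.
Qed.

Lemma shrink_glb p y x (m : R) :
  (forall t, 0 <= t -> m <= p (x + t%:C *: y) - t * p y) -> m <= shrink p y x.
Proof.
move=> mP; apply: lb_le_inf; last by move=> _ [t t0 <-]; exact: mP.
by eexists; exists 0 => /=.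
Qed.

Lemma shrink_le p y x : sublinear p -> shrink p y x <= p x.
Proof.
by move=> sp; have := shrink_lb y x sp (lexx 0);
  rewrite scale0r addr0 mul0r subr0.
Qed.

Lemma shrink_sublinear p y : sublinear p -> sublinear (shrink p y).
Proof.
move=> sp; split=> [x1 x2|a x].
  rewrite -lerBlDr; apply: shrink_glb => t t0; rewrite lerBlDr [leRHS]addrC.
  rewrite -lerBlDr; apply: shrink_glb => s s0; rewrite lerBlDr.
  have ts0 : 0 <= t + s by rewrite addr_ge0.
  have := shrink_lb y (x1 + x2) sp ts0.
  move/le_trans; apply; rewrite rmorphD scalerDl addrACA mulrDl.
  by have := sp.1 (x1 + t%:C *: y) (x2 + s%:C *: y); lra.
rewrite le_eqVlt => /orP[/eqP <-|a0].
  rewrite scale0r mul0r -(sublinear0 sp); exact: shrink_le.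
rewrite -ler_pdivrMl//; apply: shrink_glb => t t0; rewrite ler_pdivrMl//.
have at0 : 0 <= a * t by rewrite mulr_ge0// ltW.
apply: le_trans (shrink_lb y _ sp at0) _.
rewrite rmorphM/= -scalerA -scalerDr mulrBr mulrA lerD2r.
by rewrite sp.2// ltW.
Qed.

(** By minimality [shrink q y = q]; the term [t = 1] of the infimum then reads
[q x <= q (x + y) - q y]. *)
Lemma minimal_sublinear_additive q : sublinear q ->
  (forall r, sublinear r -> (forall x, r x <= q x) -> r = q) ->
  {morph q : x y / x + y}.
Proof.
move=> sq qmin x y; apply/le_anti; rewrite sq.1/=.
have sE := qmin _ (shrink_sublinear y sq) (fun x => shrink_le y x sq).
have := shrink_lb y x sq ler01.
by rewrite sE scale1r mul1r lerBrDr.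
Qed.

(** Pointwise infima of chains are sublinear and are bounded below by
[- p (- x)], so Zorn's lemma applies to the sublinear minorants of [p]. *)
Lemma sublinear_minimal p : sublinear p ->
  exists q, [/\ sublinear q, forall x, q x <= p x &
    forall r, sublinear r -> (forall x, r x <= q x) -> r = q].
Proof.
move=> sp; pose T := {q : V -> R | sublinear q /\ forall x, q x <= p x}.
pose rel (q r : T) := `[< forall x, sval r x <= sval q x >].
have [| | |A Atot|q qmax] := @Zorn T rel.
- by move=> q; apply/asboolP => x.
- move=> q r s /asboolP qr /asboolP rs; apply/asboolP => x.
  exact: le_trans (rs x) (qr x).
- move=> [q sq] [r sr] /asboolP/= qr /asboolP/= rq; apply: eq_exist.
  by apply/funext => x; apply/le_anti; rewrite qr rq.
- have [->|/set0P[q0 Aq0]] := eqVneq A set0.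
    by exists (exist _ p (conj sp (fun x => lexx (p x)))).
  pose m x := inf [set sval q x | q in A].
  have m_le (q : T) x : A q -> m x <= sval q x.
    move=> Aq; apply: ge_inf; last by exists q.
    exists (- p (- x)) => _ [r Ar <-]; have [sr rp] := svalP r.
    by apply: le_trans (sublinear_geN x sr); rewrite lerN2.
  have le_m x (c : R) : (forall q : T, A q -> c <= sval q x) -> c <= m x.
    move=> cP; apply: lb_le_inf; first by exists (sval q0 x); exists q0.
    by move=> _ [q Aq <-]; exact: cP.
  have sm : sublinear m.
    split=> [x y|a x].
      rewrite -lerBlDr; apply: (le_m) => q Aq; rewrite lerBlDr [leRHS]addrC.
      rewrite -lerBlDr; apply: (le_m) => r Ar; rewrite lerBlDr addrC.
      have [sq _] := svalP q; have [sr _] := svalP r.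
      have [/asboolP qr|/asboolP rq] := Atot _ _ Aq Ar.
        by rewrite (le_trans (m_le _ _ Ar))// (le_trans (sr.1 _ _))// lerD.
      by rewrite (le_trans (m_le _ _ Aq))// (le_trans (sq.1 _ _))// lerD.
    rewrite le_eqVlt => /orP[/eqP <-|a0].
      rewrite scale0r mul0r; have [sq _] := svalP q0.
      by rewrite (le_trans (m_le _ _ Aq0))// sublinear0.
    rewrite -ler_pdivrMl//; apply: (le_m) => q Aq; rewrite ler_pdivrMl//.
    have [sq _] := svalP q.
    by rewrite (le_trans (m_le _ _ Aq))// sq.2// ltW.
  have mp x : m x <= p x.
    by rewrite (le_trans (m_le _ x Aq0))//; have [_] := svalP q0.
  by exists (exist _ m (conj sm mp)) => q Aq; apply/asboolP => x; exact: m_le.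
have [sq qp] := svalP q; exists (sval q); split=> // r sr rq.
have rp x : r x <= p x by exact: le_trans (qp x).
by rewrite -(qmax (exist _ r (conj sr rp)))//; apply/asboolP.
Qed.

(** Minimising below [shrink p y] instead of [p] forces [q (- y) <= - p y],
which for an additive [q] is [p y <= q y]. *)
Lemma hahn_banach_real p y : sublinear p ->
  exists q, [/\ sublinear q, {morph q : x z / x + z}, forall x, q x <= p x &
    q y = p y].
Proof.
move=> sp.
have [q [sq qs qmin]] := sublinear_minimal (shrink_sublinear y sp).
have qD := minimal_sublinear_additive sq qmin.
have qp x : q x <= p x by rewrite (le_trans (qs x))// shrink_le.
exists q; split=> //; apply/le_anti; rewrite qp/=.
have : q (- y) <= - p y.
  have := shrink_lb y (- y) sp ler01.
  rewrite scale1r addNr mul1r sublinear0// sub0r => h.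
  exact: le_trans (qs _) h.
have : q (- y) + q y = 0 by rewrite -qD addNr sublinear0.
lra.
Qed.

End sublinear.

(** * Norming functionals on complex normed spaces *)

Section complex_modulus.
Variables (R : realType).
Implicit Types (z w : R[i]) (r : R).

Lemma rnorm_real r : 0 <= r -> rnorm (r%:C : R[i]^o) = r.
Proof. by move=> r0; rewrite /rnorm ger0_norm// ler0c. Qed.

Lemma rnorm_scale (V : normedModType R[i]) z (x : V) :
  rnorm (z *: x) = rnorm (z : R[i]^o) * rnorm x.
Proof. exact: rnormZ. Qed.

Lemma rnormN (V : normedModType R[i]) (x : V) : rnorm (- x) = rnorm x.
Proof. by rewrite /rnorm normrN. Qed.

Lemma ReD z w : complex.Re (z + w) = complex.Re z + complex.Re w.
Proof. by case: z w => [a b] [c d]. Qed.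

Lemma ReZ r z : complex.Re (r%:C * z) = r * complex.Re z.
Proof. by case: z => a b /=; rewrite mul0r subr0. Qed.

Lemma Re_le_rnorm z : complex.Re z <= rnorm (z : R[i]^o).
Proof.
have := normc_ge_Re z; rewrite (@rnormE R R[i]^o) lecR.
exact: le_trans (ler_norm _).
Qed.

(** Multiplying by a unit scalar turns a bound on real parts into one on
moduli. *)
Lemma rnorm_phase z :
  exists2 c : R[i], rnorm (c : R[i]^o) = 1 & c * z = (rnorm (z : R[i]^o))%:C.
Proof.
have [->|z0] := eqVneq z 0.
  by exists 1; rewrite ?mulr0 ?rnorm0// /rnorm normr1.
exists (`|z| / z); last by rewrite divfK// (@rnormE R R[i]^o).
by rewrite /rnorm normrM normfV normr_id divff// normr_eq0.
Qed.

Lemma real_of_rnorm_le_Re z r : 0 <= r -> complex.Re z = r ->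
  rnorm (z : R[i]^o) <= r -> z = r%:C.
Proof.
case: z => a b /= r0 ->; rewrite -lecR -(@rnormE R R[i]^o) normc_def/= lecR.
rewrite -[leRHS](ger0_norm r0) -[leRHS]sqrtr_sqr.
rewrite ler_sqrt ?sqr_ge0// -subr_ge0 opprD addrA subrr sub0r.
rewrite oppr_ge0 => b2; have : b ^+ 2 == 0 by rewrite eq_le b2 sqr_ge0.
by rewrite sqrf_eq0 => /eqP ->.
Qed.

End complex_modulus.

Section norming_functional.
Variables (R : realType) (X : normedModType R[i]).

Lemma rnorm_sublinear : sublinear (@rnorm R X).
Proof.
split=> [x y|a x a0]; first exact: rnormD.
by rewrite rnorm_scale rnorm_real.
Qed.

(** The complexification [q(x) - i q(i x)] of a real norming functional [q];
rotating [x] so that the value becomes real bounds its modulus by [rnorm x]. *)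
Lemma norming_functional (u : X) :
  exists2 f : {linear X -> R[i]^o},
    forall x, rnorm (f x) <= rnorm x & f u = (rnorm u)%:C.
Proof.
have [q [sq qD qp qu]] := hahn_banach_real u rnorm_sublinear.
have qN x : q (- x) = - q x.
  by apply/eqP; rewrite -addr_eq0 -qD addNr (sublinear0 sq).
have qZ (a : R) x : q (a%:C *: x) = a * q x.
  have [a0|/ltW a0] := leP 0 a; first exact: sublinear_eqZ.
  rewrite -[a]opprK rmorphN scaleNr qN.
  by rewrite (sublinear_eqZ _ sq) ?oppr_ge0// !mulNr.
(* the imaginary part is dictated by complex linearity *)
pose f x : R[i]^o := q x +i* (- q ('i%C *: x)).
have f_lin : linear f.
  move=> [a b] x y; rewrite /f scalerDr !qD.
  have -> : a +i* b = a%:C + b%:C * 'i%C.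
    by rewrite [LHS]complexE/= mulrC.
  have ii : 'i%C *: ((a%:C + b%:C * 'i%C) *: x) =
      a%:C *: ('i%C *: x) - b%:C *: x.
    rewrite !scalerA mulrDr [_ * a%:C]mulrC mulrCA -expr2 sqr_i mulrN1.
    by rewrite scalerDl scaleNr.
  rewrite ii scalerDl -!scalerA !qD qN !qZ.
  by apply/eqP; rewrite eq_complex /=; apply/andP; split; apply/eqP; ring.
pose F : {linear X -> R[i]^o} :=
  HB.pack f (GRing.isLinear.Build _ _ _ _ f f_lin).
have F_le x : rnorm (F x) <= rnorm x.
  have [c c1 cF] := rnorm_phase (F x).
  have : F (c *: x) = (rnorm (F x))%:C by rewrite linearZ.
  move=> /(congr1 (@complex.Re R)) /= <-.
  by rewrite (le_trans (qp _))// rnorm_scale c1 mul1r.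
exists F => //; apply: real_of_rnorm_le_Re => //.
exact: rnorm_ge0.
Qed.

End norming_functional.

(** * Mean values of polynomials over roots of unity *)

Lemma prim_root_exists (C : numClosedFieldType) (n : nat) : (0 < n)%N ->
  exists w : C, n.-primitive_root w.
Proof.
move=> n0; have [r Dp] := closed_field_poly_normal ('X^n - 1 : {poly C}).
rewrite (monicP _) ?monicXnsubC// scale1r in Dp.
have rn : all n.-unity_root r by apply/allP => w; rewrite -root_prod_XsubC -Dp.
have szr : (n < (size r).+1)%N.
  by rewrite -(size_prod_XsubC r id) -Dp size_XnsubC.
have [|w _ pw] := hasP (has_prim_root n0 rn _ szr); last by exists w.
by rewrite -separable_prod_XsubC -Dp separable_Xn_sub_1// pnatr_eq0 -lt0n.
Qed.

Section mean_value.
Variables (R : realType) (X Y : normedModType R[i]) (k : nat).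

(** The arguments are replaced by [a + z b] one at a time, which makes the
value a polynomial in [z] of degree at most the number of replaced arguments. *)
Lemma multilinear_line (A : ('I_k -> X) -> Y) (a b : X) : multilinear A ->
  exists c : nat -> Y, forall z : R[i],
    A (fun=> a + z *: b) = \sum_(i < k.+1) z ^+ i *: c i.
Proof.
move=> mA.
have H m : (m <= k)%N -> forall v : 'I_k -> X, exists c : nat -> Y, forall z,
    A (fun i => if (i < m)%N then a + z *: b else v i) =
    \sum_(i < m.+1) z ^+ i *: c i.
  elim: m => [_ v|m IH mk v].
    by exists (fun=> A v) => z; rewrite big_ord1 expr0 scale1r.
  have [ca Eca] := IH (ltnW mk) (dfwith v (Ordinal mk) a).
  have [cb Ecb] := IH (ltnW mk) (dfwith v (Ordinal mk) b).
  exists (fun i => (if (i <= m)%N then ca i else 0) +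
                   (if i is j.+1 then cb j else 0)) => z.
  pose w x (i : 'I_k) :=
    if (i < m)%N then a + z *: b else dfwith v (Ordinal mk) x i.
  have wE x : w x = dfwith (w 0) (Ordinal mk) x.
    apply/funext => j; case: dfwithP => [|j' jm].
      by rewrite /w /= ltnn dfwithin.
    by rewrite /w !dfwithout.
  have -> : (fun i : 'I_k => if (i < m.+1)%N then a + z *: b else v i) =
      w (z *: b + a).
    apply/funext => j; rewrite /w ltnS leq_eqVlt orbC [z *: b + a]addrC.
    case: ltnP => //= _; case: dfwithP => [|j' /eqP jm]; first by rewrite eqxx.
    by case: eqP => // jm'; case: jm; apply/val_inj.
  rewrite wE (mA (w 0) (Ordinal mk)) -!wE Eca Ecb.
  under [RHS]eq_bigr do rewrite scalerDr.
  rewrite big_split/= addrC; congr (_ + _).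
    rewrite [RHS]big_ord_recr/= ltnn scaler0 addr0; apply: eq_bigr => i _.
    by rewrite -ltnS ltn_ord.
  rewrite [RHS]big_ord_recl/= scaler0 add0r scaler_sumr; apply: eq_bigr => i _.
  by rewrite scalerA -exprS.
have [c cE] := H k (leqnn k) (fun=> 0).
exists c => z; rewrite -cE; congr A; apply/funext => i.
by rewrite ltn_ord.
Qed.

(** Along a line [P] is a polynomial in [z] of degree at most [k], so the [k]
nonconstant monomials average out over the [k + 1] roots of unity. *)
Lemma hpoly_mean_value (P : X -> Y) (w : R[i]) (a b : X) : hpoly k P ->
  k.+1.-primitive_root w ->
  k.+1%:R *: P a = \sum_(j < k.+1) P (a + w ^+ j *: b).
Proof.
move=> [_ [A [mA PA]]] pw; have [c Ec] := multilinear_line a b mA.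
have -> : P a = c 0%N.
  have := Ec 0; rewrite scale0r addr0 -PA => ->.
  rewrite big_ord_recl big1 ?addr0 ?expr0 ?scale1r// => i _.
  by rewrite expr0n/= scale0r.
under eq_bigr do rewrite PA Ec.
rewrite exchange_big/= big_ord_recl [X in _ + X]big1 => [|i _].
  under eq_bigr do rewrite expr0 scale1r.
  by rewrite addr0 sumr_const card_ord scaler_nat.
rewrite -scaler_suml.
have wi1 : w ^+ lift ord0 i != 1.
  rewrite -(prim_order_dvd pw); apply/negP => /dvdn_leq.
  by rewrite lift0 => /(_ isT); rewrite ltnS leqNgt ltn_ord.
have : (w ^+ lift ord0 i - 1) * \sum_(j < k.+1) (w ^+ lift ord0 i) ^+ j = 0.
  by rewrite -subrX1 exprAC (prim_expr_order pw) expr1n subrr.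
move=> /eqP; rewrite mulf_eq0 subr_eq0 (negbTE wi1)/= => /eqP w0.
by under eq_bigr do rewrite exprAC; rewrite w0 scale0r.
Qed.

(** A quantitative maximum principle: if the value at the centre [a] is close
to the bound 1, so is the value at each vertex of the polygon, in particular at
[a + b], because none of the averaged values exceeds 1. *)
Lemma hpoly_boundary_value (P : X -> Y) (a b : X) : hpoly k P ->
  (forall x, rnorm x <= 1 -> rnorm (P x) <= 1) ->
  (forall z : R[i], rnorm (z : R[i]^o) = 1 -> rnorm (a + z *: b) <= 1) ->
  k.+1%:R * rnorm (P a) <= rnorm (P (a + b)) + k%:R.
Proof.
move=> hP P1 ab1; have [w pw] := prim_root_exists R[i] (ltn0Sn k).
have w1 j : rnorm (w ^+ j : R[i]^o) = 1.
  have /eqP : `|w| ^+ k.+1 = 1 by rewrite -normrX (prim_expr_order pw) normr1.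
  rewrite pexpr_eq1// => /eqP nw.
  by rewrite /rnorm normrX nw expr1n.
have -> : k.+1%:R * rnorm (P a) = rnorm (k.+1%:R *: P a).
  by rewrite rnorm_scale /rnorm normr_nat -(rmorph_nat (real_complex R)).
rewrite (hpoly_mean_value a b hP pw) big_ord_recl expr0 scale1r.
rewrite (le_trans (rnormD _ _))// lerD2l.
have rs (n : nat) (F : 'I_n -> Y) : (forall i, rnorm (F i) <= 1) ->
    rnorm (\sum_(i < n) F i) <= n%:R.
  elim: n F => [|n IH] F F1; first by rewrite big_ord0 rnorm0.
  rewrite big_ord_recr/= (le_trans (rnormD _ _))//.
  by rewrite -natr1 lerD// IH.
by apply: rs => i; rewrite P1// ab1.
Qed.

End mean_value.

(** * Suprema over the ball and numerical ranges *)

Section ballnorm_theory.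
Variables (R : realType) (X Y : normedModType R[i]).
Implicit Types f : X -> Y.

Lemma ballnorm_le f (M : R) : (forall x, rnorm x <= 1 -> rnorm (f x) <= M) ->
  ballnorm f <= M.
Proof.
move=> fM; apply: ge_sup; first by exists (rnorm (f 0)), 0; rewrite //= rnorm0.
by move=> _ [x x1 <-]; exact: fM.
Qed.

Lemma le_ballnorm f (M : R) x : (forall x, rnorm x <= 1 -> rnorm (f x) <= M) ->
  rnorm x <= 1 -> rnorm (f x) <= ballnorm f.
Proof.
move=> fM x1; apply: ub_le_sup; last by exists x.
by exists M => _ [y y1 <-]; exact: fM.
Qed.

Lemma ballnorm1_has_sup f : ballnorm f = 1 ->
  has_sup [set rnorm (f x) | x in [set x : X | rnorm x <= 1]].
Proof.
move=> f1; apply: contrapT => /sup_out; rewrite -/(ballnorm f) f1.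
by move/eqP; rewrite oner_eq0.
Qed.

Lemma ballnorm1_le f x : ballnorm f = 1 -> rnorm x <= 1 -> rnorm (f x) <= 1.
Proof.
move=> f1 x1; rewrite -f1; apply: sup_upper_bound (ballnorm1_has_sup f1) _ _.
by exists x.
Qed.

Lemma ballnorm1_approx f (e : R) : ballnorm f = 1 -> 0 < e ->
  exists2 x, rnorm x <= 1 & 1 - e < rnorm (f x).
Proof.
move=> f1 e0; have [_ [x x1 <-]] := sup_adherent e0 (ballnorm1_has_sup f1).
by rewrite -/(ballnorm f) f1; exists x.
Qed.

End ballnorm_theory.

Section functionals.
Variables (R : realType) (Y : normedModType R[i]).
Implicit Types f : {linear Y -> R[i]^o}.

(** This makes the homogeneous norm estimate available for functionals. *)
Lemma hpoly_linear f : continuous f -> hpoly 1 f.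
Proof.
move=> cf; split=> //; exists (fun v => f (v ord0)); split=> // v i a x y.
by rewrite (ord1 i) !dfwithin linearP.
Qed.

Lemma dual_sphere_le f y : dual_sphere f -> rnorm (f y) <= rnorm y.
Proof.
move=> [cf f1]; rewrite -[rnorm y]expr1.
by apply: hpoly_bound => //; exact: hpoly_linear.
Qed.

End functionals.

Lemma continuous_complex (R : realType) :
  continuous (fun p : R * R => p.1 +i* p.2 : R[i]^o).
Proof.
have rc : continuous (fun r : R => r%:C : R[i]^o).
  move=> r; apply/cvgrPdist_lt => e e0.
  have eE : e = (complex.Re e)%:C by rewrite RRe_real ?gtr0_real.
  have re0 : 0 < complex.Re e by rewrite -ltcR -eE.
  have /cvgrPdist_lt/(_ _ re0) : (s @[s --> r] --> r) by exact: cvg_id.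
  apply: filterS => s rs; rewrite -rmorphB eE normc_def/= expr0n addr0.
  by rewrite sqrtr_sqr ltcR.
move=> p; rewrite (_ : (fun _ => _) =
    (fun p : R * R => (p.1%:C : R[i]^o) + 'i%C *: (p.2%:C : R[i]^o)));
  last first.
  by apply/funext => -[a b]; rewrite [LHS]complexE.
apply: cvgD; last apply: cvgZr.
  apply: (@cvg_comp _ _ _ fst (fun r : R => r%:C : R[i]^o)).
    exact: cvg_fst.
  exact: rc.
apply: (@cvg_comp _ _ _ snd (fun r : R => r%:C : R[i]^o)).
  exact: cvg_snd.
exact: rc.
Qed.

Lemma rnorm_ball (R : realType) (V : normedModType R[i]) (x : V) (e : R) :
  0 < e ->
  nbhs x [set y | rnorm (x - y) < e].
Proof.
move=> e0; have /nbhs_ballP : exists2 d : R[i], 0 < d &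
    ball x d `<=` [set y | rnorm (x - y) < e].
  exists e%:C; first by rewrite ltcR.
  by move=> y; rewrite -ball_normE /= rnormE ltcR.
exact.
Qed.

Section numerical_range.
Variables (R : realType) (X Y : normedModType R[i]).
Variables (Q P : X -> Y).

Definition near_norming (d : R) (f : {linear Y -> R[i]^o}) (x : X) :=
  [/\ dual_sphere f, rnorm x = 1 & 1 - d < complex.Re (f (Q x))].

Lemma num_rangeP (t : R[i]^o) : num_range Q P t <->
  (forall d e : R, 0 < d -> 0 < e -> exists f x,
    near_norming d f x /\ rnorm (t - f (P x)) < e).
Proof.
split=> [Vt d e d0 e0|H d d0 B /nbhs_ballP[e /= e0 eB]].
  have [_ [[f [x [sf x1 fQ ->]]] te]] := Vt d d0 _ (rnorm_ball t e0).
  by exists f, x.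
have eE : e = (complex.Re e)%:C by rewrite RRe_real ?gtr0_real.
have re0 : 0 < complex.Re e by rewrite -ltcR -eE.
have [f [x [[sf x1 fQ] te]]] := H d _ d0 re0.
exists (f (P x)); split; first by exists f, x.
by apply: eB; rewrite -ball_normE /= rnormE eE ltcR.
Qed.

Lemma num_radius_le (c : R) : 0 <= c ->
  (forall t, num_range Q P t -> rnorm t <= c) -> num_radius Q P <= c.
Proof.
move=> c0 Vc; rewrite /num_radius.
have [->|/set0P ne] := eqVneq [set rnorm t | t in num_range Q P] set0.
  by rewrite sup0.
by apply: ge_sup => // _ [t Vt <-]; exact: Vc.
Qed.

Hypothesis P1 : forall x, rnorm x <= 1 -> rnorm (P x) <= 1.

Lemma near_norming_le1 d f x : near_norming d f x -> rnorm (f (P x)) <= 1.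
Proof.
by move=> [sf x1 _]; rewrite (le_trans (dual_sphere_le _ sf))// P1// x1.
Qed.

Lemma num_range_le1 t : num_range Q P t -> rnorm t <= 1.
Proof.
move=> /num_rangeP Vt; apply/ler_addgt0Pr => e e0.
have [f [x [nfx te]]] := Vt _ _ ltr01 e0.
rewrite -[t](subrK (f (P x))) addrC (le_trans (rnormD _ _))//.
by rewrite lerD// ?(near_norming_le1 nfx)// ltW.
Qed.

Lemma num_radius_ub t : num_range Q P t -> rnorm t <= num_radius Q P.
Proof.
move=> Vt; apply: ub_le_sup; last by exists t.
by exists 1 => _ [s Vs <-]; exact: num_range_le1.
Qed.

Lemma num_radius_ge0 : 0 <= num_radius Q P.
Proof.
rewrite /num_radius.
have [->|/set0P[_ [t Vt _]]] := eqVneq [set rnorm t | t in num_range Q P] set0.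
  by rewrite sup0.
exact: le_trans (rnorm_ge0 t) (num_radius_ub Vt).
Qed.

(** The closed sets of values [f (P x)] of modulus at least [c - s] taken at
pairs that norm [Q] up to [s] decrease with [s] and lie in a compact square, so
they have a common point; it belongs to the numerical range and has modulus at
least [c]. *)
Lemma le_num_radius (c : R) :
  (forall s : R, 0 < s -> exists f x,
    near_norming s f x /\ c - s <= rnorm (f (P x))) ->
  c <= num_radius Q P.
Proof.
move=> H.
pose W (s : R) := [set t : R[i]^o | exists f x,
  [/\ near_norming s f x, t = f (P x) & c - s <= rnorm t]].
pose F := filter_from [set s : R | 0 < s] W.
have FF : ProperFilter F.
  apply: filter_from_proper; last first.
    by move=> s s0; have [f [x [nfx cs]]] := H s s0; exists (f (P x)), f, x.
  apply: filter_from_filter; first by exists 1 => /=.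
  move=> r s /= r0 s0; exists (Num.min r s); first by rewrite /= lt_min r0 s0.
  move=> t [f [x [[sf x1 fQ] -> ct]]].
  have mr : Num.min r s <= r by rewrite ge_min lexx.
  have ms : Num.min r s <= s by rewrite ge_min lexx orbT.
  by split; exists f, x; split=> //; [split=> // | | split=> // |]; lra.
pose K : set R[i]^o :=
  (fun p : R * R => p.1 +i* p.2 : R[i]^o) @`
    (`[-1, 1]%classic `*` `[-1, 1]%classic).
have cK : compact K.
  apply: continuous_compact; last first.
    by apply: compact_setX; exact: segment_compact.
  by apply: continuous_subspaceT => p; exact: continuous_complex.
have FK : F K.
  exists 1 => //= t [f [x [/near_norming_le1 + -> _]]].
  case: (f (P x)) => a b; rewrite /rnorm normc_def/= => ab1.
  have ab0 : 0 <= a ^+ 2 + b ^+ 2 by rewrite addr_ge0// sqr_ge0.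
  exists (a, b) => //=; rewrite !in_itv/= -!ler_norml; split.
    by apply: le_trans ab1; rewrite -sqrtr_sqr ler_sqrt// lerDl sqr_ge0.
  by apply: le_trans ab1; rewrite -sqrtr_sqr ler_sqrt// lerDr sqr_ge0.
have [t [_ clt]] := cK F FF FK.
have Wt d e : 0 < d -> 0 < e -> exists f x,
    [/\ near_norming d f x, c - d <= rnorm (f (P x)) & rnorm (t - f (P x)) < e].
  move=> d0 e0.
  have FW : F (W d) by exists d.
  have [_ [[f [x [nfx -> cd]]] te]] := clt _ _ FW (rnorm_ball t e0).
  by exists f, x.
have Vt : num_range Q P t.
  apply/num_rangeP => d e d0 e0; have [f [x []]] := Wt _ _ d0 e0.
  by exists f, x.
apply: le_trans (num_radius_ub Vt); apply/ler_addgt0Pr => e e0.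
have e20 : 0 < e / 2 by rewrite divr_gt0.
have [f [x [_ ce te]]] := Wt _ _ e20 e20.
have : rnorm (f (P x)) <= rnorm t + rnorm (t - f (P x)).
  by rewrite -[in leLHS](subKr t (f (P x))) (le_trans (rnormD _ _))// rnormN.
lra.
Qed.

End numerical_range.

(** * Composition with linear maps; coordinates of the sum *)

Lemma bounded_linear_continuous (R : realType) (V W : normedModType R[i])
    (g : {linear V -> W}) (M : R) : 0 < M ->
  (forall x, rnorm (g x) <= M * rnorm x) -> continuous g.
Proof.
move=> M0 gM x; apply/cvgrPdist_lt => e e0.
have eE : e = (complex.Re e)%:C by rewrite RRe_real ?gtr0_real.
have re0 : 0 < complex.Re e by rewrite -ltcR -eE.
apply: filterS (rnorm_ball x (divr_gt0 re0 M0)) => y /= xy.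
by rewrite eE -linearB rnormE ltcR (le_lt_trans (gM _))// mulrC -ltr_pdivlMr.
Qed.

Section hpoly_comp.
Variables (R : realType) (X Y W : normedModType R[i]) (k : nat).

Lemma hpoly_comp_linearl (P : X -> Y) (N : {linear Y -> W}) :
  hpoly k P -> continuous N -> hpoly k (N \o P).
Proof.
move=> [cP [A [mA PA]]] cN; split=> [x|].
  by apply: continuous_comp; [exact: cP|exact: cN].
exists (N \o A); split; last by move=> x /=; rewrite PA.
by move=> v i a x y /=; rewrite mA linearP.
Qed.

Lemma hpoly_comp_linearr (P : Y -> W) (L : {linear X -> Y}) :
  hpoly k P -> continuous L -> hpoly k (P \o L).
Proof.
move=> [cP [A [mA PA]]] cL; split=> [x|].
  by apply: continuous_comp; [exact: cL|exact: cP].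
exists (fun v => A (fun i => L (v i))); split; last by move=> x /=; rewrite PA.
move=> v i a x y.
have E u : (fun j => L (dfwith v i u j)) = dfwith (fun j => L (v j)) i (L u).
  apply/funext => j; case: dfwithP => [|j' ij]; first by rewrite dfwithin.
  by rewrite dfwithout.
by rewrite !E linearP mA.
Qed.

End hpoly_comp.

Section ballnorm_scale.
Variables (R : realType) (X Y : normedModType R[i]).

Lemma ballnorm_scaleV (f : X -> Y) (M : R) :
  (forall x, rnorm x <= 1 -> rnorm (f x) <= M) -> 0 < ballnorm f ->
  ballnorm (fun x => (ballnorm f)^-1%:C *: f x) = 1.
Proof.
move=> fM; set s := ballnorm f => s0.
have nE x : rnorm (s^-1%:C *: f x) = s^-1 * rnorm (f x).
  by rewrite rnorm_scale rnorm_real// invr_ge0 ltW.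
have le1 x : rnorm x <= 1 -> rnorm (s^-1%:C *: f x) <= 1.
  by move=> x1; rewrite nE ler_pdivrMl// mulr1 (le_ballnorm fM).
apply/le_anti; rewrite ballnorm_le//=.
rewrite -(ler_pM2l s0) mulr1; apply: ballnorm_le => x x1.
by rewrite -ler_pdivrMl// -nE (le_ballnorm le1).
Qed.

End ballnorm_scale.

Section dsum_theory.
Variables (R : realType) (Lam : Type) (E : seqspace).
Variable X : Lam -> completeNormedModType R[i].
Implicit Types (l j : Lam) (x : dsum E X).

Lemma dsum_rnorm_le x (M : R) : 0 <= M -> (forall l, rnorm (x l) <= M) ->
  rnorm x <= M.
Proof.
move=> M0 xM; rewrite dsum_rnormE.
have [->|/set0P ne0] := eqVneq (range (fun l => rnorm (x l))) set0.
  by rewrite sup0.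
by apply: ge_sup => // _ [l _ <-].
Qed.

(** Transport along [l = j] is needed as the summands depend on the index, and
the case distinction is classical as the index type is arbitrary. *)
Definition single_fun l (y : X l) j : X j :=
  if pselect (l = j) is left e
  then eq_rect l (fun i => X i : Type) y j e else 0.

Lemma single_fun_eq l (y : X l) : single_fun y l = y.
Proof.
rewrite /single_fun; case: pselect => // e.
by rewrite (Prop_irrelevance e erefl).
Qed.

Lemma single_fun_neq l (y : X l) j : l <> j -> single_fun y j = 0.
Proof. by rewrite /single_fun; case: pselect. Qed.

Fact single_mem l (y : X l) : seqspace_mem E (fun j => rnorm (single_fun y j)).
Proof.
have H j : l <> j -> `|rnorm (single_fun y j)| = 0.
  by move=> lj; rewrite single_fun_neq// rnorm0 normr0.
case: E => /= [e e0|].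
  apply: (@sub_finite_set _ _ [set l]) => [j /= ej|]; last exact: finite_set1.
  by apply: contrapT => jl; move: ej; rewrite H ?leNgt ?e0//; apply/nesym.
exists (rnorm y) => j; have [<-|lj] := pselect (l = j).
  by rewrite single_fun_eq ger0_norm// rnorm_ge0.
by rewrite H// rnorm_ge0.
Qed.

Definition dsum_single l (y : X l) : dsum E X := Dsum (single_mem y).

Lemma dsum_single_eq l (y : X l) : dsum_single y l = y.
Proof. exact: single_fun_eq. Qed.

Lemma dsum_single_neq l (y : X l) j : l <> j -> dsum_single y j = 0.
Proof. exact: single_fun_neq. Qed.

Definition dsum_coord l x : X l := x l.

Fact dsum_single_linear l : linear (@dsum_single l).
Proof.
move=> a y z; apply: dsumP => j /=; have [<-|lj] := pselect (l = j).
  by rewrite !single_fun_eq.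
by rewrite !single_fun_neq// scaler0 addr0.
Qed.

HB.instance Definition _ l :=
  GRing.isLinear.Build R[i] (X l) (dsum E X) _ (@dsum_single l)
    (@dsum_single_linear l).

Lemma dsum_singleZ l (a : R[i]) (y : X l) :
  dsum_single (a *: y) = a *: dsum_single y.
Proof. exact: linearZ. Qed.

Fact dsum_coord_linear l : linear (@dsum_coord l).
Proof. by []. Qed.

HB.instance Definition _ l :=
  GRing.isLinear.Build R[i] (dsum E X) (X l) _ (@dsum_coord l)
    (@dsum_coord_linear l).

Lemma rnorm_single l (y : X l) : rnorm (dsum_single y) = rnorm y.
Proof.
apply/le_anti/andP; split.
  apply: dsum_rnorm_le => [|j]; first exact: rnorm_ge0.
  have [<-|lj] := pselect (l = j); first by rewrite dsum_single_eq.
  by rewrite dsum_single_neq// rnorm0 rnorm_ge0.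
by rewrite -{1}(dsum_single_eq y) dsum_coord_le.
Qed.

Lemma continuous_single l : continuous (@dsum_single l).
Proof.
by apply: (bounded_linear_continuous ltr01) => y; rewrite rnorm_single mul1r.
Qed.

Lemma continuous_coord l : continuous (@dsum_coord l).
Proof.
by apply: (bounded_linear_continuous ltr01) => y; rewrite mul1r dsum_coord_le.
Qed.

End dsum_theory.

(** * Transporting polynomials between the sum and a summand *)

Section dsum_index.
Variables (R : realType) (Lam : Type) (E : seqspace).
Variables (X Y : Lam -> completeNormedModType R[i]) (k : nat).
Variable Q : forall l, X l -> Y l.
Hypotheses (k0 : (0 < k)%N) (hQ : forall l, hpoly k (@Q l))
  (nQ : forall l, ballnorm (@Q l) = 1).

Let Qsum : dsum E X -> dsum E Y := dsum_map k0 hQ nQ.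

Let Q_le1 l (y : X l) : rnorm y <= 1 -> rnorm (Q y) <= 1.
Proof. exact: ballnorm1_le. Qed.

(** Rotate [y] so that [f (single y)] becomes real and nonnegative: the sum on
the left is then the real part of the value of [f] at a vector with coordinate
[c y], [c] a unit scalar, in place [l] and those of [Q x] elsewhere, which lies
in the unit ball. *)
Lemma dsum_functional_split (f : {linear dsum E Y -> R[i]^o}) (x : dsum E X) l
    (y : Y l) : dual_sphere f -> rnorm x <= 1 -> rnorm y <= 1 ->
  rnorm (f (dsum_single E y)) +
    complex.Re (f (Qsum x - dsum_single E (Q (x l)))) <= 1.
Proof.
move=> sf x1 y1; have [c c1 cE] := rnorm_phase (f (dsum_single E y)).
set r := Qsum x - _.
have le1 : rnorm (dsum_single E (c *: y) + r) <= 1.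
  apply: dsum_rnorm_le => // j; rewrite /r /=.
  have [<-|lj] := pselect (l = j).
    by rewrite !single_fun_eq subrr addr0 rnorm_scale c1 mul1r.
  rewrite !single_fun_neq// add0r subr0 Q_le1//.
  exact: le_trans (dsum_coord_le x j) x1.
apply: le_trans (le_trans (dual_sphere_le _ sf) le1).
apply: le_trans (Re_le_rnorm _).
have -> : f (dsum_single E (c *: y) + r) = c * f (dsum_single E y) + f r.
  by rewrite [LHS]linearD dsum_singleZ linearZ.
by rewrite cE ReD.
Qed.

Section upper_bound.
Variables (l : Lam) (P : X l -> Y l).
Hypotheses (hP : hpoly k P) (nP : ballnorm P = 1).

Let Pext : dsum E X -> dsum E Y :=
  (@dsum_single _ _ E Y l \o P) \o @dsum_coord _ _ E X l.

Lemma hpoly_extend : hpoly k Pext.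
Proof.
apply: (hpoly_comp_linearr (L := @dsum_coord _ _ E X l)); last first.
  exact: continuous_coord.
by apply: hpoly_comp_linearl hP _; exact: continuous_single.
Qed.

Let Pext_le1 x : rnorm x <= 1 -> rnorm (Pext x) <= 1.
Proof.
move=> x1; rewrite rnorm_single (ballnorm1_le nP)//.
exact: le_trans (dsum_coord_le x l) x1.
Qed.

Lemma ballnorm_extend : ballnorm Pext = 1.
Proof.
apply/le_anti; rewrite ballnorm_le//=; apply/ler_addgt0Pr => e e0.
have [y y1 ey] := ballnorm1_approx nP e0.
rewrite -lerBlDr (le_trans (ltW ey))//.
have -> : rnorm (P y) = rnorm (Pext (dsum_single E y)).
  by rewrite rnorm_single /= /dsum_coord /= single_fun_eq.
by apply: (le_ballnorm Pext_le1); rewrite rnorm_single.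
Qed.

(** With [g] the restriction of [f] to [Y l] and [a] its norm, splitting [f]
gives [a - s ^+ 2 < Re (g (Q (x l)))], and [s < a] since the value of [g] at
[P (x l)] exceeds [s].  Hence [s ^+ 2 < s * a], and normalising both [g] and
[x l], which can only increase the moduli, leaves an error below [s]. *)
Lemma near_norming_restrict (s : R) f x : 0 < s -> s < 1 ->
  near_norming Qsum (s ^+ 2) f x -> s < rnorm (f (Pext x)) ->
  exists g y, near_norming (@Q l) s g y /\
    rnorm (f (Pext x)) <= rnorm (g (P y)).
Proof.
move=> s0 s1 [sf x1 fQ] sP.
pose g : {linear Y l -> R[i]^o} := f \o @dsum_single _ _ E Y l.
pose rho := complex.Re (f (Qsum x - dsum_single E (Q (x l)))).
have xl1 : rnorm (x l) <= 1 by rewrite -x1 dsum_coord_le.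
have g_rho y : rnorm y <= 1 -> rnorm (g y) <= 1 - rho.
  by move=> y1; rewrite lerBrDr; apply: dsum_functional_split; rewrite // x1.
have g_le y : rnorm (g y) <= rnorm y.
  by rewrite (le_trans (dual_sphere_le _ sf))// rnorm_single.
pose a := ballnorm g.
have ga y : rnorm y <= 1 -> rnorm (g y) <= a by exact: le_ballnorm g_rho.
have a_rho : a <= 1 - rho by exact: ballnorm_le.
have a1 : a <= 1 by apply: ballnorm_le => y y1; exact: le_trans (g_le y) y1.
have sa : s < a by rewrite (lt_le_trans sP)// ga// (ballnorm1_le nP).
have a0 : 0 < a by exact: lt_trans sa.
(* 1 - s^2 < Re g(Q(x l)) + rho and a + rho <= 1, while s^2 < a s *)
have gQ : a * (1 - s) < complex.Re (g (Q (x l))).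
  have : complex.Re (f (Qsum x)) = complex.Re (g (Q (x l))) + rho.
    have := linearD f (dsum_single E (Q (x l)))
      (Qsum x - dsum_single E (Q (x l))).
    by rewrite addrC subrK => ->; exact: ReD.
  have : s * s <= a * s by rewrite ler_pM2r// ltW.
  move: fQ a_rho; rewrite expr2; lra.
pose r := rnorm (x l).
have r0 : 0 < r.
  rewrite lt_def rnorm_ge0 andbT; apply/eqP => r0.
  have := hpoly_bound k0 hP nP (x l); rewrite -/r r0 expr0n gtn_eqF//=.
  have := g_le (P (x l)); rewrite -[f _]/(g (P (x l))) in sP *; lra.
have rk : 1 <= r^-1 ^+ k by rewrite exprn_ege1// invf_ge1.
pose h : {linear Y l -> R[i]^o} := a^-1%:C \*: g.
have sh : dual_sphere h.
  split.
    apply: (bounded_linear_continuous (M := a^-1)); first by rewrite invr_gt0.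
    move=> y; rewrite rnorm_scale rnorm_real ?invr_ge0 ?(ltW a0)//.
    by rewrite ler_pM2l ?invr_gt0.
  exact: ballnorm_scaleV g_rho a0.
have hE (T : X l -> Y l) : hpoly k T ->
    h (T (r^-1%:C *: x l)) = (a^-1 * r^-1 ^+ k)%:C *: g (T (x l)).
  move=> hT; rewrite (hpolyZ hT) -rmorphXn linearZ /=.
  by rewrite rmorphM/= !scalerA mulrC.
exists h, (r^-1%:C *: x l); split; [split=> //|].
- by rewrite rnorm_scale rnorm_real ?invr_ge0 ?rnorm_ge0// mulVf// gt_eqF.
- rewrite hE//.
  rewrite ReZ.
  have : 1 - s < a^-1 * complex.Re (g (Q (x l))) by rewrite ltr_pdivlMl.
  move=> /lt_le_trans; apply; rewrite mulrAC ler_peMr//.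
  rewrite mulr_ge0 ?invr_ge0 ?(ltW a0)// (le_trans _ (ltW gQ))//.
  by rewrite mulr_ge0 ?(ltW a0)// subr_ge0 ltW.
- rewrite hE// rnorm_scale rnorm_real; last first.
    by rewrite mulr_ge0 ?invr_ge0 ?exprn_ge0 ?invr_ge0 ?ltW.
  by rewrite ler_peMl ?rnorm_ge0// mulr_ege1// invf_ge1.
Qed.

Lemma num_radius_extend : num_radius Qsum Pext <= num_radius (@Q l) P.
Proof.
have P_le1 y : rnorm y <= 1 -> rnorm (P y) <= 1 by exact: ballnorm1_le.
have v0 := num_radius_ge0 (@Q l) P_le1.
apply: num_radius_le => // t Vt.
have [->//|t0] := eqVneq (rnorm t) 0.
have {}t0 : 0 < rnorm t by rewrite lt_def t0 rnorm_ge0.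
apply: le_num_radius => // s s0.
(* r <= rnorm t / 3 excludes the case where f (P x) is as small as r *)
pose r := Num.min (s / 2) (Num.min (1 / 2) (rnorm t / 3)).
have r0 : 0 < r by rewrite !lt_min; apply/and3P; split; lra.
have rs : r <= s / 2 by rewrite ge_min lexx.
have r12 : r <= 1 / 2 by rewrite !ge_min lexx orbT.
have rt : r <= rnorm t / 3 by rewrite !ge_min lexx !orbT.
have r1 : r < 1 by lra.
have [f [x [nfx tf]]] := (num_rangeP _ _ _).1 Vt _ _ (exprn_gt0 2 r0) r0.
have tr : rnorm t - r < rnorm (f (Pext x)).
  have : rnorm t <= rnorm (t - f (Pext x)) + rnorm (f (Pext x)).
    by rewrite -[in leLHS](subrK (f (Pext x)) t) rnormD.
  lra.
have [|g [y [[sg y1 gQ] fg]]] := near_norming_restrict r0 r1 nfx; first by lra.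
exists g, y; split; [split=> //|]; lra.
Qed.

End upper_bound.

(** For [y = 0] any unit vector does; there is one because [Q] is not zero. *)
Lemma exists_unit l (y : X l) : exists u (t : R),
  [/\ rnorm u = 1, t = rnorm y & y = t%:C *: u].
Proof.
have normalise (w : X l) : 0 < rnorm w -> rnorm ((rnorm w)^-1%:C *: w) = 1.
  by move=> w0; rewrite rnorm_scale rnorm_real ?mulVf ?gt_eqF// invr_ge0 ltW.
have [y0|y0] := eqVneq (rnorm y) 0.
  have [w w1 Qw] := ballnorm1_approx (nQ l) (@ltr01 R).
  have w0 : 0 < rnorm w.
    rewrite lt_def rnorm_ge0 andbT; apply/eqP => w0.
    have := hpoly_bound k0 (hQ l) (nQ l) w; rewrite w0 expr0n gtn_eqF//=; lra.
  exists ((rnorm w)^-1%:C *: w), 0; split=> //; first exact: normalise.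
  by rewrite scale0r; apply: rnorm0_eq0.
have {}y0 : 0 < rnorm y by rewrite lt_def y0 rnorm_ge0.
exists ((rnorm y)^-1%:C *: y), (rnorm y); split=> //; first exact: normalise.
by rewrite scalerA -rmorphM divff ?gt_eqF// scale1r.
Qed.

Section lower_bound.
Variable P : dsum E X -> dsum E Y.
Hypotheses (hP : hpoly k P) (nP : ballnorm P = 1).

(** A point where one coordinate of [P] is almost 1 can be moved so that this
coordinate of the point itself is a unit vector [u]: if [x l = t u], apply the
maximum principle on the disc of centre [x] and radius [1 - t] in the direction
of [u], which stays inside the ball. *)
Lemma boundary_coord (e : R) : 0 < e -> e < 1 ->
  exists l (x : dsum E X) (u : X l),
  [/\ rnorm x <= 1, rnorm u = 1 &
      1 - e < rnorm (P (dsum_single E u + (x - dsum_single E (x l))) l)].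
Proof.
move=> e0 e1.
(* averaging over k + 1 points multiplies the defect by k + 1 *)
pose d := e / k.+1%:R.
have k1 : 0 < k.+1%:R :> R by rewrite ltr0Sn.
have d0 : 0 < d by rewrite divr_gt0.
have dk : k.+1%:R * d = e by rewrite /d mulrC divfK// gt_eqF.
have d1 : d < 1.
  by rewrite (le_lt_trans _ e1)// /d ler_pdivrMr// ler_peMr ?(ltW e0)// ler1n.
have [x x1 xP] := ballnorm1_approx nP d0.
have [l lP] : exists l, 1 - d < rnorm (P x l).
  apply: contrapT => H; suff : rnorm (P x) <= 1 - d by rewrite leNgt xP.
  apply: dsum_rnorm_le => [|l]; first by lra.
  by rewrite leNgt; apply/negP => lP; apply: H; exists l.
have [u [t [u1 tE xlE]]] := exists_unit (x l).
have t0 : 0 <= t by rewrite tE rnorm_ge0.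
have t1 : t <= 1 by rewrite tE (le_trans (dsum_coord_le x l)).
exists l, x, u; split=> //.
pose b := dsum_single E ((1 - t)%:C *: u).
have -> : dsum_single E u + (x - dsum_single E (x l)) = x + b.
  by rewrite xlE /b !dsum_singleZ rmorphB rmorph1 scalerBl scale1r addrCA.
pose Pl := @dsum_coord _ _ E Y l \o P.
have hPl : hpoly k Pl := hpoly_comp_linearl hP (@continuous_coord _ _ E Y l).
have Pl1 y : rnorm y <= 1 -> rnorm (Pl y) <= 1.
  move=> y1; apply: le_trans (dsum_coord_le (P y) l) _.
  exact: ballnorm1_le nP y1.
have xb (z : R[i]) : rnorm (z : R[i]^o) = 1 -> rnorm (x + z *: b) <= 1.
  move=> z1; apply: dsum_rnorm_le => // j /=; have [<-|lj] := pselect (l = j).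
    rewrite single_fun_eq (le_trans (rnormD _ _))// -tE !rnorm_scale z1 u1.
    by rewrite rnorm_real; lra.
  by rewrite single_fun_neq// scaler0 addr0 (le_trans (dsum_coord_le x j)).
have := hpoly_boundary_value hPl Pl1 xb.
have : k.+1%:R * (1 - d) < k.+1%:R * rnorm (P x l) by rewrite ltr_pM2l.
by rewrite mulrBr mulr1 dk /= /dsum_coord -natr1; lra.
Qed.

(** The isometry [T y = single y + f y *: z], where [f] norms [u] and [z]
vanishes at [l], pulls [P] back to a polynomial on [X l] whose norm [a] is
at least [1 - e]; dividing by [a] costs at most [e], as radii are at most 1. *)
Lemma num_radius_compress (e : R) : 0 < e -> e < 1 ->
  exists l (S : X l -> Y l), [/\ hpoly k S, ballnorm S = 1 &
    num_radius (@Q l) S <= num_radius Qsum P + e].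
Proof.
move=> e0 e1; have [l [x [u [x1 u1 uP]]]] := boundary_coord e0 e1.
have P_le1 y : rnorm y <= 1 -> rnorm (P y) <= 1 by exact: ballnorm1_le.
set z := x - _ in uP.
have [f f_le fu] := norming_functional u.
pose T0 y := dsum_single E y + f y *: z.
have T_lin : linear T0.
  move=> a y y'; have fP : f (a *: y + y') = a * f y + f y' by exact: linearP.
  rewrite /T0 fP [dsum_single E _]linearP scalerDl -scalerA.
  by rewrite [a *: (dsum_single E y + _)]scalerDr addrACA.
pose T : {linear X l -> dsum E X} :=
  HB.pack T0 (GRing.isLinear.Build _ _ _ _ T0 T_lin).
have TE y j : T y j = single_fun y j + f y *: z j by [].
have zl : z l = 0 by rewrite /z /= single_fun_eq subrr.
have Tl y : T y l = y by rewrite TE single_fun_eq zl scaler0 addr0.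
have nT y : rnorm (T y) = rnorm y.
  apply/le_anti/andP; split; last by rewrite -{1}(Tl y) dsum_coord_le.
  apply: dsum_rnorm_le => [|j]; first exact: rnorm_ge0.
  have [<-|lj] := pselect (l = j); first by rewrite Tl.
  rewrite TE single_fun_neq// add0r rnorm_scale /z /= single_fun_neq// subr0.
  by rewrite -[leRHS]mulr1 ler_pM ?rnorm_ge0// (le_trans (dsum_coord_le x j)).
have cT : continuous T.
  by apply: (bounded_linear_continuous ltr01) => y; rewrite nT mul1r.
pose S0 := (@dsum_coord _ _ E Y l \o P) \o T.
have hS0 : hpoly k S0.
  have hPl := hpoly_comp_linearl hP (@continuous_coord _ _ E Y l).
  exact: hpoly_comp_linearr hPl cT.
have S0_le1 y : rnorm y <= 1 -> rnorm (S0 y) <= 1.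
  move=> y1; apply: le_trans (dsum_coord_le _ l) _.
  by rewrite P_le1// nT.
pose a := ballnorm S0.
have a1 : a <= 1 by exact: ballnorm_le.
have ae : 1 - e <= a.
  have uS : rnorm (S0 u) <= a by apply: (le_ballnorm S0_le1); rewrite u1.
  apply: le_trans uS; move: uP; rewrite /S0 /= /dsum_coord /T0 fu u1 scale1r.
  exact: ltW.
have a0 : 0 < a by lra.
pose h : {linear Y l -> Y l} := a^-1%:C \*: idfun.
have hS : hpoly k (h \o S0).
  apply: hpoly_comp_linearl hS0 _.
  apply: (bounded_linear_continuous (M := a^-1)); first by rewrite invr_gt0.
  by move=> y; rewrite rnorm_scale rnorm_real ?invr_ge0 ?(ltW a0).
exists l, (h \o S0); split=> //.
  exact: ballnorm_scaleV S0_le1 a0.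
have S1 : ballnorm (h \o S0) = 1 by exact: ballnorm_scaleV S0_le1 a0.
have v0 := num_radius_ge0 Qsum P_le1.
apply: num_radius_le => [|t Vt]; first by lra.
have t1 : rnorm t <= 1.
  by apply: num_range_le1 Vt => y; exact: ballnorm1_le.
have aV : num_range Qsum P (a%:C *: t).
  apply/num_rangeP => d eta d0 eta0.
  have [g [y [[sg y1 gQ] tg]]] := (num_rangeP _ _ _).1 Vt _ _ d0 eta0.
  pose G : {linear dsum E Y -> R[i]^o} := g \o @dsum_coord _ _ E Y l.
  have sG : dual_sphere G.
    split.
      move=> w; apply: continuous_comp; first exact: continuous_coord.
      exact: sg.1.
    have G1 w : rnorm w <= 1 -> rnorm (G w) <= 1.
      move=> w1; rewrite (le_trans (dual_sphere_le _ sg))//.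
      exact: le_trans (dsum_coord_le w l) w1.
    apply/le_anti; rewrite ballnorm_le//=; rewrite -[in leLHS]sg.2.
    apply: ballnorm_le => w w1.
    have -> : rnorm (g w) = rnorm (G (dsum_single E w)).
      by rewrite /= /dsum_coord /= single_fun_eq.
    by apply: (le_ballnorm G1); rewrite rnorm_single.
  exists G, (T y); split; first split=> //.
  - by rewrite nT.
  - by rewrite [G _]/(g (Q (T y l))) Tl.
  have -> : a%:C *: t - G (P (T y)) = a%:C *: (t - g ((h \o S0) y)).
    have -> : g ((h \o S0) y) = a^-1%:C *: (G (P (T y)) : R[i]^o).
      exact: linearZZ.
    by rewrite scalerBr scalerA -rmorphM divff ?gt_eqF// scale1r.
  rewrite rnorm_scale rnorm_real ?(ltW a0)// (le_lt_trans _ tg)//.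
  by rewrite ler_piMl// rnorm_ge0.
have := num_radius_ub P_le1 aV.
rewrite rnorm_scale rnorm_real ?(ltW a0)// => av.
have := rnorm_ge0 t; nra.
Qed.

End lower_bound.

End dsum_index.

(** * The index of the sum *)

Lemma num_index_le (R : realType) (X Y : normedModType R[i]) (k : nat)
    (Q P : X -> Y) : hpoly k P -> ballnorm P = 1 ->
  num_index k Q <= num_radius Q P.
Proof.
move=> hP nP; apply: ge_inf; last by exists P.
exists 0 => _ [S [_ nS] <-]; apply: num_radius_ge0 => x.
exact: ballnorm1_le.
Qed.

Lemma num_index_ge0 (R : realType) (X Y : normedModType R[i]) (k : nat)
    (Q : X -> Y) : 0 <= num_index k Q.
Proof.
rewrite /num_index; set A := (X in inf X).
have [->|/set0P ne] := eqVneq A set0; first by rewrite inf0.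
apply: lb_le_inf => // _ [P [_ nP] <-]; apply: num_radius_ge0 => x.
exact: ballnorm1_le.
Qed.

Theorem proposition4p5 (R : realType) (k : nat) (k_gt0 : (0 < k)%N)
    (Lam : Type) (E : seqspace) (X Y : Lam -> completeNormedModType R[i])
    (Q : forall l : Lam, X l -> Y l)
    (Q_poly : forall l, hpoly k (Q l))
    (Q_norm1 : forall l, ballnorm (Q l) = 1) :
  num_index k (dsum_map k_gt0 Q_poly Q_norm1 : dsum E X -> dsum E Y) =
  inf [set num_index k (Q l) | l in [set: Lam]].
Proof.
have half : 0 < 1 / 2 :> R by lra.
have half1 : 1 / 2 < 1 :> R by lra.
have lb : has_lbound [set num_index k (Q l) | l in [set: Lam]].
  by exists 0 => _ [l _ <-]; exact: num_index_ge0.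
pose Qsum : dsum E X -> dsum E Y := dsum_map k_gt0 Q_poly Q_norm1.
(* over an empty index type both infima are taken over the empty set *)
have [[l0 _]|noL] := pselect (exists l : Lam, True); last first.
  rewrite /num_index (_ : [set num_radius _ P | P in _] = set0); last first.
    apply/seteqP; split=> // t [P [hP nP] _].
    have [l _] := num_radius_compress k_gt0 Q_poly Q_norm1 hP nP half half1.
    by apply: noL; exists l.
  rewrite (_ : [set _ | _ in _] = set0)//.
  by apply/seteqP; split=> // t [l _ _]; apply: noL; exists l.
apply/le_anti/andP; split.
  apply: lb_le_inf; first by exists (num_index k (Q l0)), l0.
  move=> _ [l _ <-]; apply: lb_le_inf.
    by exists (num_radius (Q l) (Q l)), (Q l).
  move=> _ [S [hS nS] <-].
  apply: le_trans (num_radius_extend E k_gt0 Q_poly Q_norm1 hS nS).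
  by apply: num_index_le; [exact: hpoly_extend|exact: ballnorm_extend].
apply: lb_le_inf.
  pose P := (@dsum_single _ _ E Y l0 \o Q l0) \o @dsum_coord _ _ E X l0.
  exists (num_radius Qsum P), P => //.
  by split; [exact: hpoly_extend|exact: ballnorm_extend].
move=> _ [S [hS nS] <-]; apply/ler_addgt0Pr => e e0.
pose d := Num.min e (1 / 2).
have d0 : 0 < d by rewrite lt_min e0.
have d1 : d < 1 by rewrite (le_lt_trans _ half1)// ge_min lexx orbT.
have de : d <= e by rewrite ge_min lexx.
have [l [T [hT nT vT]]] := num_radius_compress k_gt0 Q_poly Q_norm1 hS nS d0 d1.
apply: (@le_trans _ _ (num_index k (Q l))).
  by apply: ge_inf => //; exists l.
apply: le_trans (num_index_le _ hT nT) _.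
by apply: le_trans vT _; rewrite lerD2l.
Qed.
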